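(* Consider either the Payne-Whitham (PW) model or the inhomogeneous Aw-Rascle-Zhang (ARZ) model, with functions $U$ and $p$ (respectively $h$) satisfying the assumptions stated in the context. The effective flow rate of a periodic chain of identical jamitons is always lower than the flow rate of the uniform base state solution with the same average density. That is, for every jamiton, with average density $\bar\rho$ and effective flow rate $\bar Q$ (both averaged over one full jamiton, from shock to shock), $$\bar Q<Q_{\mathrm{eq}}(\bar\rho),\qquad\text{where } Q_{\mathrm{eq}}(\rho)=\rho\,U(1/\rho).$$
   Context: Setting. $I=(v_{\min},\infty)$ with $v_{\min}\ge 0$ is the interval of admissible specific volumes $v=1/\rho$ ($\rho$ is the vehicle density; typically $v_{\min}=1/\rho_{\max}$). The relaxation time is $\tau>0$. The functions $U,p,h:I\to\mathbb{R}$ (desired velocity, traffic pressure, hesitation; regarded as functions of $v$) are twice continuously differentiable with $U'>0$, $U''<0$, $p'<0$, $p''>0$, $h'<0$, $h''>0$ on $I$. Models in Lagrangian variables ($\sigma$ = vehicle number, $u$ = velocity): PW: $v_t-u_\sigma=0$, $\;u_t+(p(v))_\sigma=\frac1\tau(U(v)-u)$. ARZ: $v_t-u_\sigma=0$, $\;(u+h(v))_t=\frac1\tau(U(v)-u)$. The uniform base state with density $\rho$ is $v\equiv1/\rho$, $u\equiv U(1/\rho)$, whose flow rate is $Q_{\mathrm{eq}}(\rho)$. Jamiton. A jamiton with sonic value $v_S\in I$ is a traveling wave in the variable $\chi=(mt+\sigma)/\tau$, where $m>0$ is given by $m=\sqrt{-p'(v_S)}$ (PW) or $m=-h'(v_S)$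 (ARZ), consisting of a smooth part of finite length with an attached shock traveling at the same speed. Precisely, it is a pair of $C^1$ functions $(v(\chi),u(\chi))$ on a compact interval $[\chi^+,\chi^-]$, $\chi^+<\chi^-$, with $v$ taking values in $I$, such that: (1) $m v'-u'=0$ and, for PW, $m u'+p'(v)v'=U(v)-u$, respectively, for ARZ, $m u'+m h'(v)v'=U(v)-u$, on $[\chi^+,\chi^-]$; (2) writing $(v^\pm,u^\pm)=(v(\chi^\pm),u(\chi^\pm))$, the shock with left state $(v^-,u^-)$ and right state $(v^+,u^+)$ satisfies the Rankine-Hugoniot conditions: for PW, $m[v]-[u]=0$ and $m[u]+[p(v)]=0$; for ARZ, $m[v]-[u]=0$ and $[u]+[h(v)]=0$, where $[z]$ is the jump of $z$ across the shock; (3) the shock satisfies the Lax entropy condition, which here reads $v^->v^+$. A periodic chain of identical jamitons is obtained by repeating such a profile periodically, consecutive copies being connected by the shock. Averages. The Eulerian self-similar variable $\eta=(x-st)/\tau$, with $s=u-mv$ constant along the jamiton, satisfies $d\eta=v\,d\chi$. The length of the jamiton and the number of vehicles in it (in the $\eta$ variable) are $L=\int_{\chi^+}^{\chi^-}v\,d\chi$ and $N=\int\rho\,d\eta=\int_{\chi^+}^{\chi^-}1\,d\chi$. The average density is $\bar\rho=N/L$, and the effective flow rate is the average of $Q=\rho u$ over one full jamiton with respect to $\eta$: $\bar Q=\frac1L\int\rho u\,d\eta=\frac1L\int_{\chi^+}^{\chi^-}u\,d\chi$. *)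

(* Defs.v *)
From Stdlib Require Import Reals.
From Coquelicot Require Import Coquelicot.
Open Scope R_scope.

(* The real numbers are Stdlib's [R]; integrals and interior derivatives are
   Coquelicot's.  Functions on the open interval I = (vmin, oo) are
   represented by total functions [R -> R], constrained on I only. *)

Definition volumes (vmin v : R) : Prop := vmin < v.

Definition C2_on_volumes (vmin : R) (f : R -> R) : Prop :=
  forall v, volumes vmin v ->
    ex_derive f v /\ ex_derive_n f 2 v /\ continuous (Derive_n f 2) v.

Definition desired_velocity (vmin : R) (U : R -> R) : Prop :=
  C2_on_volumes vmin U /\
  forall v, volumes vmin v -> 0 < Derive U v /\ Derive_n U 2 v < 0.

(* The traffic pressure and the hesitation obey the same assumptions. *)
Definition decreasing_convex (vmin : R) (f : R -> R) : Prop :=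
  C2_on_volumes vmin f /\
  forall v, volumes vmin v -> Derive f v < 0 /\ 0 < Derive_n f 2 v.

(* [PW p]:  v_t - u_sigma = 0,  u_t + (p(v))_sigma = (U(v) - u) / tau.
   [ARZ h]: v_t - u_sigma = 0,  (u + h(v))_t = (U(v) - u) / tau. *)
Inductive traffic_model : Type :=
  | PW (p : R -> R)
  | ARZ (h : R -> R).

Definition admissible_model (vmin : R) (M : traffic_model) : Prop :=
  match M with
  | PW p => decreasing_convex vmin p
  | ARZ h => decreasing_convex vmin h
  end.

Definition wave_slope (M : traffic_model) (vS : R) : R :=
  match M with
  | PW p => sqrt (- Derive p vS)
  | ARZ h => - Derive h vS
  end.

(* [D_in] and [continue_in] are relative to the domain, so the derivatives at
   the endpoints are one-sided and values of [f] outside [a, b] play no role. *)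
Definition C1_on (a b : R) (f df : R -> R) : Prop :=
  forall x, a <= x <= b ->
    D_in f df (fun y => a <= y <= b) x /\
    continue_in df (fun y => a <= y <= b) x.

(* Traveling wave equations in chi = (m t + sigma) / tau at a point with state
   (v, u) and derivatives (dv, du) in chi; the scaling of chi makes the
   relaxation time tau > 0 cancel. *)
Definition wave_equations (U : R -> R) (M : traffic_model) (m v u dv du : R)
  : Prop :=
  m * dv - du = 0 /\
  match M with
  | PW p => m * du + Derive p v * dv = U v - u
  | ARZ h => m * du + m * Derive h v * dv = U v - u
  end.

Definition rankine_hugoniot (M : traffic_model) (m vl ul vr ur : R) : Prop :=
  m * (vr - vl) - (ur - ul) = 0 /\
  match M with
  | PW p => m * (ur - ul) + (p vr - p vl) = 0
  | ARZ h => (ur - ul) + (h vr - h vl) = 0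
  end.

(* A shock joins each copy of the profile to the next one, so its left state
   is the value at the right end [chim] of the smooth part, and its right
   state the value at the left end [chip]. *)
Definition jamiton (vmin : R) (U : R -> R) (M : traffic_model)
    (vS chip chim : R) (v u : R -> R) : Prop :=
  let m := wave_slope M vS in
  volumes vmin vS /\
  chip < chim /\
  (forall x, chip <= x <= chim -> volumes vmin (v x)) /\
  (exists dv du : R -> R,
     C1_on chip chim v dv /\
     C1_on chip chim u du /\
     forall x, chip <= x <= chim ->
       wave_equations U M m (v x) (u x) (dv x) (du x)) /\
  rankine_hugoniot M m (v chim) (u chim) (v chip) (u chip) /\
  v chip < v chim.

(* Integral over one jamiton in the Eulerian variable eta, d eta = v d chi, of
   a field [f] given as a function of chi. *)
Definition eta_integral (chip chim : R) (v f : R -> R) : R :=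
  RInt (fun x => f x * v x) chip chim.

Definition jamiton_length (chip chim : R) (v : R -> R) : R :=
  eta_integral chip chim v (fun _ => 1).

Definition vehicle_number (chip chim : R) (v : R -> R) : R :=
  eta_integral chip chim v (fun x => / v x).

Definition average_density (chip chim : R) (v : R -> R) : R :=
  vehicle_number chip chim v / jamiton_length chip chim v.

Definition effective_flow_rate (chip chim : R) (v u : R -> R) : R :=
  eta_integral chip chim v (fun x => / v x * u x) / jamiton_length chip chim v.

Definition Q_eq (U : R -> R) (rho : R) : R := rho * U (1 / rho).

(* Main.v *)
Require Import Defs.
From Stdlib Require Import Reals Lra.
From Coquelicot Require Import Coquelicot.
Open Scope R_scope.

(** Integrating the momentum equation over the smooth part gives the jump of
    [m u + p(v)] (PW) or of [m (u + h(v))] (ARZ), which vanishes by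
    Rankine-Hugoniot; hence [u] and [U(v)] have the same average in chi.  As [U]
    is strictly concave and [v] is not constant, Jensen's inequality then says
    that the average of [u] is less than [U] of the average [L / N] of [v]. *)

(* The profiles are only known on [[a, b]]; composing them with [clamp a b]
   makes them continuous on [R], as Coquelicot's lemmas require. *)
Definition clamp (a b x : R) : R := Rmax a (Rmin b x).

Lemma clamp_id (a b x : R) : a <= x <= b -> clamp a b x = x.
Proof.
  intros Hx; unfold clamp, Rmax, Rmin.
  destruct (Rle_dec b x); destruct (Rle_dec a _); lra.
Qed.

Lemma clamp_range (a b x : R) : a <= b -> a <= clamp a b x <= b.
Proof.
  intros Hab; unfold clamp, Rmax, Rmin.
  destruct (Rle_dec b x); destruct (Rle_dec a _); lra.
Qed.

Lemma clamp_lipschitz (a b x y : R) :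
  Rabs (clamp a b y - clamp a b x) <= Rabs (y - x).
Proof.
  unfold clamp, Rmax, Rmin.
  destruct (Rle_dec b x); destruct (Rle_dec b y);
    repeat (destruct (Rle_dec a _)); unfold Rabs;
    repeat (destruct (Rcase_abs _)); lra.
Qed.

(** Since [clamp a b] is 1-Lipschitz, the [delta] of [f] at [clamp a b x] also serves at [x]. *)
Lemma continuous_clamp (a b : R) (f : R -> R) : a <= b ->
  (forall x, a <= x <= b -> continue_in f (fun y => a <= y <= b) x) ->
  forall x, continuous (fun y => f (clamp a b y)) x.
Proof.
  intros Hab Hf x.
  apply continuity_pt_filterlim.
  intros eps Heps.
  destruct (Hf _ (clamp_range a b x Hab) eps Heps) as [d [Hd H]].
  exists d; split; [exact Hd|].
  intros y [_ Hy]; simpl in *; unfold Rdist in *.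
  (* [continue_in] only speaks of points other than the limit point, whereas [clamp] may merge [y]
     with [x]; in that case the two values coincide. *)
  destruct (Req_dec (clamp a b y) (clamp a b x)) as [E|E].
  - rewrite E, Rminus_diag, Rabs_R0; exact Heps.
  - apply H; split.
    + split; [apply clamp_range; exact Hab | congruence].
    + eapply Rle_lt_trans; [apply clamp_lipschitz | exact Hy].
Qed.

(** Near an interior point [clamp] is the identity; at an endpoint it may create a kink, hence the
    strict bounds on [x]. *)
Lemma is_derive_clamp (a b : R) (f df : R -> R) (x : R) : a < x < b ->
  D_in f df (fun y => a <= y <= b) x ->
  is_derive (fun y => f (clamp a b y)) x (df x).
Proof.
  intros Hx Hf.
  apply is_derive_Reals.
  intros eps Heps.
  destruct (Hf eps Heps) as [d [Hd H]].
  assert (Hpos : 0 < Rmin d (Rmin (x - a) (b - x))).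
  { repeat apply Rmin_glb_lt; lra. }
  exists (mkposreal _ Hpos); simpl; intros h Hh0 Hh.
  assert (Hd1 := Rmin_l d (Rmin (x - a) (b - x))).
  assert (Hd2 := Rmin_r d (Rmin (x - a) (b - x))).
  assert (Ha := Rmin_l (x - a) (b - x)).
  assert (Hb := Rmin_r (x - a) (b - x)).
  assert (Hh' := Rabs_def2 _ _ Hh).
  rewrite !clamp_id by lra.
  specialize (H (x + h)); simpl in H; unfold Rdist, D_x in H.
  replace (x + h - x) with h in H by ring.
  apply H; repeat split; lra.
Qed.

(** * Integrals of continuous functions *)

Lemma ex_RInt_continuous_R (f : R -> R) (a b : R) :
  (forall x, continuous f x) -> ex_RInt f a b.
Proof.
  intros Hf; apply (ex_RInt_continuous (V := R_CompleteNormedModule)); auto.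
Qed.

(** A version of the fundamental theorem that tolerates kinks of clamped profiles at [a] and [b]:
    [F - RInt g a] is continuous with zero derivative inside, so the mean value theorem equates its
    two end values. *)
Lemma RInt_derive_interior (F g : R -> R) (a b : R) : a < b ->
  (forall x, continuous F x) -> (forall x, continuous g x) ->
  (forall x, a < x < b -> is_derive F x (g x)) ->
  RInt g a b = F b - F a.
Proof.
  intros Hab HF Hg HD.
  assert (HG : forall x, is_derive (RInt g a) x (g x)).
  { intros x; apply (is_derive_RInt g (RInt g a) a x); [|apply Hg].
    exists (mkposreal 1 Rlt_0_1); intros y _.
    apply (RInt_correct g a y), ex_RInt_continuous_R, Hg. }
  destruct (MVT_gen (fun x => F x - RInt g a x) a b (fun _ => 0)) as [c [_ Hc]].
  - rewrite Rmin_left, Rmax_right by lra.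
    intros x Hx.
    replace 0 with (g x - g x) by ring.
    apply (is_derive_minus F (RInt g a)); auto.
  - intros x _; apply continuity_pt_filterlim.
    apply (continuous_minus F (RInt g a)); [apply HF|].
    apply ex_derive_continuous; eexists; apply HG.
  - rewrite RInt_point in Hc; unfold zero in Hc; simpl in Hc; lra.
Qed.

(** By continuity [g] is positive on a short interval [[l, r]] around [c], and the rest of [[a, b]]
    contributes a nonnegative amount. *)
Lemma RInt_pos_of_pos_at (g : R -> R) (a b c : R) : a < b -> a <= c <= b ->
  (forall x, continuous g x) -> (forall x, 0 <= g x) -> 0 < g c ->
  0 < RInt g a b.
Proof.
  intros Hab Hc Hg Hpos Hgc.
  assert (Hg' := proj2 (continuity_pt_filterlim g c) (Hg c)).
  destruct (Hg' (g c) Hgc) as [d [Hd H]]; simpl in H; unfold Rdist in H.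
  (* The point [c] may be an endpoint of [[a, b]]; even after clipping, [l < r] because [a < b]. *)
  set (l := Rmax a (c - d / 2)).
  set (r := Rmin b (c + d / 2)).
  assert (Hl : a <= l <= c /\ c - d / 2 <= l).
  { unfold l, Rmax; destruct (Rle_dec _ _); lra. }
  assert (Hr : c <= r <= b /\ r <= c + d / 2).
  { unfold r, Rmin; destruct (Rle_dec _ _); lra. }
  assert (Hlr : l < r).
  { unfold l, r, Rmax, Rmin; destruct (Rle_dec _ _); destruct (Rle_dec _ _); lra. }
  assert (Hex : forall x y, ex_RInt g x y).
  { intros; apply ex_RInt_continuous_R, Hg. }
  assert (Hge : forall x y, x <= y -> 0 <= RInt g x y).
  { intros; apply RInt_ge_0; auto. }
  assert (Hmid : 0 < RInt g l r).
  { apply RInt_gt_0; auto.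
    intros x Hx.
    destruct (Req_dec c x) as [<-|Hne]; [exact Hgc|].
    assert (Hx' : Rabs (g x - g c) < g c).
    { apply H; repeat split; auto. apply Rabs_def1; lra. }
    apply Rabs_def2 in Hx'; lra. }
  assert (E1 := RInt_Chasles g a l b (Hex a l) (Hex l b)).
  assert (E2 := RInt_Chasles g l r b (Hex l r) (Hex r b)).
  unfold plus in E1, E2; simpl in E1, E2.
  assert (H1 := Hge a l ltac:(lra)).
  assert (H2 := Hge r b ltac:(lra)).
  lra.
Qed.

(** * Calculus on the volume interval and the relaxation balance *)

Lemma C2_on_volumes_derive (vmin : R) (f : R -> R) (x : R) :
  C2_on_volumes vmin f -> volumes vmin x ->
  derivable_pt_lim f x (Derive f x) /\
  derivable_pt_lim (Derive f) x (Derive_n f 2 x).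
Proof.
  intros Hf Hx; destruct (Hf x Hx) as [H1 [H2 _]].
  split; apply is_derive_Reals, Derive_correct; assumption.
Qed.

(** By the mean value theorem the slope of the chord is [Derive U c] with [c] strictly between [x]
    and [y], and [Derive U] strictly decreases because [U'' < 0]. *)
Lemma desired_velocity_lt_tangent (vmin : R) (U : R -> R) (x y : R) :
  desired_velocity vmin U -> volumes vmin x -> volumes vmin y -> y <> x ->
  U y < U x + Derive U x * (y - x).
Proof.
  unfold volumes; intros [HC HU] Hx Hy Hne.
  assert (Hdecr : forall s t, vmin < s -> s < t -> Derive U t < Derive U s).
  { intros s t Hs Hst.
    destruct (MVT_cor2 (Derive U) (Derive_n U 2) s t Hst) as [c [Ec Hc]].
    - intros c Hc; apply (C2_on_volumes_derive vmin U c HC); unfold volumes; lra.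
    - assert (Hc2 := proj2 (HU c ltac:(unfold volumes; lra))).
      assert (0 < (- Derive_n U 2 c) * (t - s)) by (apply Rmult_lt_0_compat; lra).
      lra. }
  assert (Hmvt : forall s t, vmin < s -> s < t ->
    exists c, U t - U s = Derive U c * (t - s) /\ s < c < t).
  { intros s t Hs Hst; apply MVT_cor2; [exact Hst|].
    intros c Hc; apply (C2_on_volumes_derive vmin U c HC); unfold volumes; lra. }
  destruct (Rtotal_order y x) as [Hlt|[He|Hgt]]; [|contradiction|].
  - destruct (Hmvt y x Hy Hlt) as [c [Ec Hc]].
    assert (Hd := Hdecr c x ltac:(lra) ltac:(lra)).
    assert (0 < (Derive U c - Derive U x) * (x - y))
      by (apply Rmult_lt_0_compat; lra).
    lra.
  - destruct (Hmvt x y Hx Hgt) as [c [Ec Hc]].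
    assert (Hd := Hdecr x c ltac:(lra) ltac:(lra)).
    assert (0 < (Derive U x - Derive U c) * (y - x))
      by (apply Rmult_lt_0_compat; lra).
    lra.
Qed.

Lemma C2_on_volumes_comp_continuous (vmin : R) (f w : R -> R) :
  C2_on_volumes vmin f -> (forall x, volumes vmin (w x)) ->
  (forall x, continuous w x) -> forall x, continuous (fun y => f (w y)) x.
Proof.
  intros Hf Hw Hc x.
  apply (continuous_comp w f); [apply Hc|].
  apply (ex_derive_continuous f), (Hf _ (Hw x)).
Qed.

(* Covers both models: [k = 1] for PW and [k = m] for ARZ. *)
Lemma RInt_relaxation_eq0 (vmin k m a b : R) (U f w z dw dz : R -> R) : a < b ->
  C2_on_volumes vmin U -> C2_on_volumes vmin f ->
  (forall x, volumes vmin (w x)) ->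
  (forall x, continuous w x) -> (forall x, continuous z x) ->
  (forall x, a < x < b -> is_derive w x (dw x) /\ is_derive z x (dz x) /\
     m * dz x + k * Derive f (w x) * dw x = U (w x) - z x) ->
  m * (z b - z a) + k * (f (w b) - f (w a)) = 0 ->
  RInt (fun x => U (w x) - z x) a b = 0.
Proof.
  intros Hab HU Hf Hw Hcw Hcz HD HRH.
  assert (HcU := C2_on_volumes_comp_continuous vmin U w HU Hw Hcw).
  assert (Hcf := C2_on_volumes_comp_continuous vmin f w Hf Hw Hcw).
  (* The momentum equation makes [m z + k f(w)] an antiderivative of [U(w) - z]; its total increment
     is zero by the jump hypothesis. *)
  rewrite (RInt_derive_interior (fun x => m * z x + k * f (w x))).
  - lra.
  - exact Hab.
  - intros x; apply (continuous_plus (fun x => m * z x) (fun x => k * f (w x))).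
    + apply (continuous_scal_r m z), Hcz.
    + apply (continuous_scal_r k (fun x => f (w x))), Hcf.
  - intros x; apply (continuous_minus (fun x => U (w x)) z); auto.
  - intros x Hx; destruct (HD x Hx) as [Dw [Dz <-]].
    apply (is_derive_plus (fun x => m * z x) (fun x => k * f (w x))).
    + apply (is_derive_scal z x m), Dz.
    + replace (k * Derive f (w x) * dw x) with (k * (dw x * Derive f (w x)))
        by ring.
      apply (is_derive_scal (fun x => f (w x)) x k).
      apply (is_derive_comp f w x); [|exact Dw].
      apply Derive_correct, (Hf _ (Hw x)).
Qed.

(** * Strict Jensen inequality for the desired velocity *)

Lemma RInt_gt_const (g : R -> R) (a b c : R) : a < b ->
  (forall x, continuous g x) -> (forall x, c < g x) ->
  c * (b - a) < RInt g a b.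
Proof.
  intros Hab Hg Hc.
  replace (c * (b - a)) with (RInt (fun _ => c) a b).
  - apply RInt_lt; auto.
    intros; apply continuous_const.
  - rewrite RInt_const; unfold scal; simpl; unfold mult; simpl; ring.
Qed.

(** The tangent to [U] at the mean [V] of [w] lies above [U], strictly away from [V], and its
    composition with [w] integrates to [(b - a) * U V]. *)
Lemma strict_jensen_desired_velocity (vmin a b : R) (U w : R -> R) : a < b ->
  desired_velocity vmin U -> (forall x, volumes vmin (w x)) ->
  (forall x, continuous w x) -> w a <> w b ->
  RInt (fun x => U (w x)) a b < (b - a) * U (RInt w a b / (b - a)).
Proof.
  intros Hab HU Hw Hcw Hne.
  set (V := RInt w a b / (b - a)).
  assert (EV : V * (b - a) = RInt w a b) by (unfold V; field; lra).
  assert (HV : volumes vmin V).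
  { apply (Rmult_lt_reg_r (b - a)); [lra|].
    rewrite EV; apply RInt_gt_const; auto. }
  assert (HcU := C2_on_volumes_comp_continuous vmin U w (proj1 HU) Hw Hcw).
  set (T := fun x => U V + Derive U V * (w x - V)).
  assert (HT : is_RInt T a b ((b - a) * U V)).
  { replace ((b - a) * U V)
      with (plus (scal (b - a) (U V))
              (scal (Derive U V) (minus (RInt w a b) (scal (b - a) V)))).
    - apply (is_RInt_plus (fun _ => U V) (fun x => Derive U V * (w x - V))).
      + apply (is_RInt_const a b (U V)).
      + apply (is_RInt_scal (fun x => w x - V)).
        apply (is_RInt_minus w (fun _ => V)).
        * apply (RInt_correct w), ex_RInt_continuous_R, Hcw.
        * apply (is_RInt_const a b V).
    - rewrite <- EV; unfold plus, scal, minus, plus, opp; simpl; unfold mult; simpl.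
      ring. }
  assert (HcT : forall x, continuous T x).
  { intros x.
    apply (continuous_plus (fun _ => U V) (fun x => Derive U V * (w x - V))).
    - apply continuous_const.
    - apply (continuous_scal_r (Derive U V) (fun x => w x - V)).
      apply (continuous_minus w (fun _ => V)); [apply Hcw | apply continuous_const]. }
  assert (Hcg : forall x, continuous (fun x => T x - U (w x)) x).
  { intros x; apply (continuous_minus T (fun x => U (w x))); auto. }
  assert (Hlt : forall x, w x <> V -> 0 < T x - U (w x)).
  { intros x Hx.
    assert (H := desired_velocity_lt_tangent vmin U V (w x) HU HV (Hw x) Hx).
    unfold T; lra. }
  assert (Hge : forall x, 0 <= T x - U (w x)).
  { intros x; destruct (Req_dec (w x) V) as [E|E].
    - unfold T; rewrite E; lra.
    - left; apply Hlt, E. }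
  assert (Hpos : 0 < RInt (fun x => T x - U (w x)) a b).
  (* As [w a <> w b], at least one endpoint has a value different from [V], and there the gap is
     positive. *)
  { destruct (Req_dec (w a) V) as [E|E].
    - apply (RInt_pos_of_pos_at _ a b b); auto; [lra|].
      apply Hlt; congruence.
    - apply (RInt_pos_of_pos_at _ a b a); auto; lra. }
  assert (E := RInt_minus T (fun x => U (w x)) a b
                 (ex_intro _ _ HT) (ex_RInt_continuous_R _ a b HcU)).
  rewrite (is_RInt_unique _ _ _ _ HT) in E.
  unfold minus, plus, opp in E; simpl in E.
  unfold Rminus in Hpos; rewrite E in Hpos; lra.
Qed.

(** * Comparison of the flow rates *)

Theorem theorem5 (vmin : R) (U : R -> R) (M : traffic_model)
    (Hvmin : 0 <= vmin)
    (HU : desired_velocity vmin U)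
    (HM : admissible_model vmin M)
    (vS chip chim : R) (v u : R -> R)
    (HJ : jamiton vmin U M vS chip chim v u) :
  effective_flow_rate chip chim v u < Q_eq U (average_density chip chim v).
Proof.
  destruct HJ as [_ [Hab [Hv [[dv [du [Hdv [Hdu Hw]]]] [[_ HRH] Hlax]]]]].
  set (m := wave_slope M vS) in *.
  set (c := clamp chip chim).
  assert (Hr : forall x, chip <= c x <= chim).
  { intros x; apply clamp_range; lra. }
  assert (Hcont : forall f df : R -> R, C1_on chip chim f df ->
    forall x, continuous (fun y => f (c y)) x).
  { intros f df Hf; apply continuous_clamp; [lra|].
    intros x Hx; apply (cont_deriv f df), (Hf x Hx). }
  assert (Hder : forall f df : R -> R, C1_on chip chim f df ->
    forall x, chip < x < chim -> is_derive (fun y => f (c y)) x (df x)).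
  { intros f df Hf x Hx; apply is_derive_clamp; [exact Hx|].
    apply (Hf x); lra. }
  assert (Hid : forall x, chip <= x <= chim -> c x = x).
  { intros x; apply clamp_id. }
  assert (Hcv := Hcont v dv Hdv).
  assert (Hcu := Hcont u du Hdu).
  assert (Hvc : forall x, volumes vmin (v (c x))) by (intros; apply Hv, Hr).
  assert (Hrelax : RInt (fun x => U (v (c x)) - u (c x)) chip chim = 0).
  { destruct M as [p|h].
    - apply (RInt_relaxation_eq0 vmin 1 m chip chim U p
               (fun x => v (c x)) (fun x => u (c x)) dv du);
        auto; try apply HU; try apply HM.
      + intros x Hx; split; [|split]; auto.
        rewrite Hid by lra.
        assert (H := proj2 (Hw x ltac:(lra))); simpl in H; lra.
      + rewrite !Hid by lra; lra.
    - apply (RInt_relaxation_eq0 vmin m m chip chim U h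
               (fun x => v (c x)) (fun x => u (c x)) dv du);
        auto; try apply HU; try apply HM.
      + intros x Hx; split; [|split]; auto.
        rewrite Hid by lra.
        assert (H := proj2 (Hw x ltac:(lra))); simpl in H; lra.
      + rewrite !Hid by lra.
        (* The ARZ jump condition gives [[h(v)] = -[u]], so [m [u] + m [h(v)]] cancels. *)
        replace (h (v chim) - h (v chip)) with (- (u chim - u chip)) by lra.
        ring. }
  assert (Hjensen := strict_jensen_desired_velocity vmin chip chim U
    (fun x => v (c x)) Hab HU Hvc Hcv).
  cbv beta in Hjensen; rewrite !Hid in Hjensen by lra.
  (* The Lax condition [v chip < v chim] supplies the distinct end values. *)
  specialize (Hjensen ltac:(lra)).
  assert (Eu : RInt (fun x => U (v (c x))) chip chim
             = RInt (fun x => u (c x)) chip chim).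
  { assert (E := RInt_minus (fun x => U (v (c x))) (fun x => u (c x)) chip chim
      (ex_RInt_continuous_R _ _ _
         (C2_on_volumes_comp_continuous vmin U _ (proj1 HU) Hvc Hcv))
      (ex_RInt_continuous_R _ _ _ Hcu)).
    unfold minus, plus, opp in E; simpl in E.
    unfold Rminus in Hrelax; rewrite E in Hrelax; lra. }
  (* Positivity of [v] lets the density [/ v x] cancel the weight [v x] of the Eulerian integrals,
     which turns them into integrals in chi. *)
  assert (Hv0 : forall x, chip < x < chim -> v x <> 0).
  { intros x Hx; assert (H := Hv x ltac:(lra)); unfold volumes in H; lra. }
  assert (EL : jamiton_length chip chim v = RInt (fun x => v (c x)) chip chim).
  { apply RInt_ext; rewrite Rmin_left, Rmax_right by lra.
    intros x Hx; rewrite Hid by lra; simpl; ring. }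
  assert (EN : vehicle_number chip chim v = chim - chip).
  { transitivity (RInt (fun _ => 1) chip chim).
    - apply RInt_ext; rewrite Rmin_left, Rmax_right by lra.
      intros x Hx; simpl; field; auto.
    - rewrite RInt_const; unfold scal; simpl; unfold mult; simpl; ring. }
  assert (EQ : eta_integral chip chim v (fun x => / v x * u x)
             = RInt (fun x => u (c x)) chip chim).
  { apply RInt_ext; rewrite Rmin_left, Rmax_right by lra.
    intros x Hx; rewrite Hid by lra; simpl; field; auto. }
  assert (HL : 0 < RInt (fun x => v (c x)) chip chim).
  { apply Rle_lt_trans with (vmin * (chim - chip)).
    - apply Rmult_le_pos; lra.
    - apply RInt_gt_const; auto. }
  unfold effective_flow_rate, Q_eq, average_density.
  rewrite EQ, EL, EN, <- Eu.
  (* With the integrals abstracted to [S] and [L], multiplying the goal by [L > 0] gives exactly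
     Jensen's inequality. *)
  revert HL Hjensen.
  generalize (RInt (fun x => v (c x)) chip chim : R) as L.
  generalize (RInt (fun x => U (v (c x))) chip chim : R) as S.
  intros S L HL Hjensen.
  replace (1 / ((chim - chip) / L)) with (L / (chim - chip)) by (field; lra).
  apply (Rmult_lt_reg_r L); [exact HL|].
  replace (S / L * L) with S by (field; lra).
  replace ((chim - chip) / L * U (L / (chim - chip)) * L)
    with ((chim - chip) * U (L / (chim - chip))) by (field; lra).
  exact Hjensen.
Qed.
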